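(* Let $G$ be a circulant graph of odd order $n$ with connection set $S=\{s_1,\dots,s_\Delta\}\subseteq\mathbb{Z}_n\setminus\{0\}$ (so $G$ is $\Delta$-regular with $\Delta=|S|$), viewing the $s_i$ as integers in $\{1,\dots,n-1\}$. Suppose that no $s_i$ is divisible by $\Delta+1$ and that no two distinct elements $s_i,s_k$ of $S$ are congruent modulo $\Delta+1$. Then $G$ is of type I, i.e. $\chi''(G)=\Delta+1$.
   Context: A circulant graph on $n$ vertices with connection set $S$ (a subset of $\mathbb{Z}_n\setminus\{0\}$ with $S=-S$) is the Cayley graph of the cyclic group $\mathbb{Z}_n$ with respect to $S$: vertices are $0,1,\dots,n-1$ and $x\sim y$ iff $x-y\in S$. A total coloring of a simple graph is an assignment of colors to vertices and edges such that adjacent vertices, adjacent edges, and an edge and its endpoints all receive different colors; $\chi''(G)$ is the minimum number of colors in a total coloring. A graph with maximum degree $\Delta$ is of type I if $\chi''(G)=\Delta+1$. The paper calls such a graph an ''odd circulant graph''; here this is taken to mean a circulant graph on an odd number $n$ of vertices. *)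

(* Defs.v *)
From HB Require Import structures.
From mathcomp Require Import all_boot all_algebra.

Set Implicit Arguments.
Unset Strict Implicit.
Unset Printing Implicit Defensive.

Import GRing.Theory.

Record sgraph := SGraph {
  vertex :> finType;
  adj : rel vertex;
  adj_sym : symmetric adj;
  adj_irrefl : irreflexive adj
}.

Section TotalColoring.
Variable G : sgraph.

Definition edge_set : {set {set G}} :=
  [set E | [exists x : G, exists y : G, adj x y && (E == [set x; y])]].

Definition edge := {E : {set G} | E \in edge_set}.

Definition degree (x : G) : nat := #|[set y | adj x y]|.

Definition max_degree : nat := \max_(x : G) degree x.

Definition is_total_coloring (C : eqType) (cv : G -> C) (ce : edge -> C) : bool :=
  [&& [forall x : G, forall y : G, adj x y ==> (cv x != cv y)],
      [forall E : edge, forall F : edge,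
         (E != F) && (val E :&: val F != set0) ==> (ce E != ce F)]
    & [forall x : G, forall E : edge, (x \in val E) ==> (cv x != ce E)]].

Definition total_colorable (k : nat) : bool :=
  [exists cv : {ffun G -> 'I_k}, exists ce : {ffun edge -> 'I_k},
     is_total_coloring cv ce].

Lemma total_colorable_exists : exists k, total_colorable k.
Proof.
exists (#|G| + #|{: edge}|).
apply/existsP; exists [ffun x => lshift _ (enum_rank x)].
apply/existsP; exists [ffun E => rshift _ (enum_rank E)].
apply/and3P; split.
- apply/forallP=> x; apply/forallP=> y; apply/implyP=> xy.
  rewrite !ffunE eq_lshift (inj_eq enum_rank_inj).
  by apply: contraTneq xy => ->; rewrite adj_irrefl.
- apply/forallP=> E; apply/forallP=> F; apply/implyP=> /andP[neEF _].
  by rewrite !ffunE eq_rshift (inj_eq enum_rank_inj).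
- apply/forallP=> x; apply/forallP=> E; apply/implyP=> _.
  by rewrite !ffunE eq_lrshift.
Qed.

Definition total_chromatic_number : nat := ex_minn total_colorable_exists.

Definition type_I : Prop := total_chromatic_number = max_degree.+1.

End TotalColoring.

Section Circulant.
Local Open Scope ring_scope.

(* The order of the graph is n.+1: 'I_n.+1 carries the additive group of
   integers mod n.+1, including order 1, where 'Z_1 would be Z/2. *)
Variables (n : nat) (S : {set 'I_n.+1}).

Definition circulant_adj : rel 'I_n.+1 := fun x y => x - y \in S.

Hypotheses (S0 : 0 \notin S) (SN : S = [set - s | s in S]).

Lemma circulant_adj_sym : symmetric circulant_adj.
Proof.
suff h x y : circulant_adj x y -> circulant_adj y x by move=> x y; apply/idP/idP; apply: h.
by rewrite /circulant_adj => xy; rewrite -opprB SN imset_f.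
Qed.

Lemma circulant_adj_irrefl : irreflexive circulant_adj.
Proof. by move=> x; rewrite /circulant_adj subrr (negPf S0). Qed.

Definition circulant : sgraph := SGraph circulant_adj_sym circulant_adj_irrefl.

End Circulant.

(* Main.v *)
(* Reduction modulo m = #|S|.+1 maps S bijectively onto the nonzero residues.
   As S = -S, these residues are stable under r |-> n.+1 - r, which forces
   m %| n.+1; in particular m is odd.  Colour a vertex x by 2x mod m and an edge
   xy by x + y mod m: a vertex differs from its edges since x - y in S is nonzero
   mod m, two edges xy and xz differ since x - y and x - z are distinct in S,
   and adjacent vertices differ since 2 is invertible mod m. *)
Require Import Defs.
From mathcomp Require Import all_boot all_algebra.

Set Implicit Arguments.
Unset Strict Implicit.
Unset Printing Implicit Defensive.

Import GRing.Theory.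

Lemma edge_setP (G : sgraph) (E : {set G}) :
  reflect (exists x y : G, adj x y /\ E = [set x; y]) (E \in edge_set G).
Proof.
rewrite inE; apply: (iffP existsP) => [[x /existsP[y /andP[xy /eqP->]]]|].
  by exists x, y.
by case=> x [y [xy ->]]; exists x; apply/existsP; exists y; rewrite xy eqxx.
Qed.

(** Lets two edges meeting at [x] be written as [[set x; y]] and [[set x; z]] with the common
    endpoint first. *)
Lemma edge_incidentP (G : sgraph) (E : edge G) (x : G) :
  x \in val E -> exists2 y, adj x y & val E = [set x; y].
Proof.
have /edge_setP[a [b [ab ->]]] := valP E.
rewrite !inE => /orP[]/eqP->; first by exists b.
by exists a; rewrite 1?adj_sym // setUC.
Qed.

(** The vertex [x] and the edges at [x] need pairwise different colours, which makes [degree x + 1]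
    of them. *)
Lemma degree_lt_total_colorable (G : sgraph) (k : nat) (x : G) :
  total_colorable G k -> degree x < k.
Proof.
case/existsP=> cv /existsP[ce /and3P[_ edges_neq incident_neq]].
(* The colour of the edge from [x] to [y]; the default [cv x] arises only when [[set x; y]] is not
   an edge. *)
pose col y := if insub [set x; y] is Some E then ce E else cv x.
have colE y : adj x y -> exists2 E : edge G, val E = [set x; y] & col y = ce E.
  move=> xy; have Exy : [set x; y] \in edge_set G by apply/edge_setP; exists x, y.
  by exists (exist _ [set x; y] Exy : edge G) => //; rewrite /col insubT.
have col_inj : {in [set y | adj x y] &, injective col}.
  move=> y z; rewrite !inE => xy xz.
  have [[E defE ->] [F defF ->]] := (colE y xy, colE z xz).
  move/eqP; apply: contraTeq => neq_yz.
  apply: (implyP (forallP (forallP edges_neq E) F)); apply/andP; split.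
    apply/eqP=> eqEF; have : y \in val F by rewrite -eqEF defE set22.
    rewrite defF !inE (negPf neq_yz) orbF => /eqP eqyx.
    by move: xy; rewrite eqyx adj_irrefl.
  by apply/set0Pn; exists x; rewrite defE defF inE !set21.
have cvx : cv x \notin col @: [set y | adj x y].
  apply/imsetP=> -[y]; rewrite inE => /colE[E defE ->]; apply/eqP.
  by apply: (implyP (forallP (forallP incident_neq x) E)); rewrite defE set21.
rewrite /degree -(card_in_imset col_inj) -[k in _ < k]card_ord.
by have := max_card (mem (cv x |: col @: [set y | adj x y])); rewrite cardsU1 cvx.
Qed.

Lemma double_modn_inj (m x y : nat) :
  odd m -> x.*2 = y.*2 %[mod m] -> x = y %[mod m].
Proof.
move=> m_odd; wlog le_yx : x y / y <= x => [wl eq_xy|].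
  by case/orP: (leq_total x y) => /wl; [move/(_ (esym eq_xy)) | apply].
move/eqP=> eq_xy; apply/eqP; move: eq_xy.
by rewrite !eqn_mod_dvd ?leq_double // -doubleB -mul2n Gauss_dvdr ?coprimen2.
Qed.

(** The difference in ['I_n.+1] wraps around modulo [n.+1], which is invisible modulo a divisor [m]
    of [n.+1]. *)
Lemma ord_subDmod (n m : nat) (x y : 'I_n.+1) :
  m %| n.+1 -> (x - y)%R + y = x %[mod m].
Proof.
by move=> dvd_m; rewrite -[in RHS](subrK y x) /= modn_dvdm.
Qed.

Lemma degree_circulant (n : nat) (S : {set 'I_n.+1})
    (S0 : (0%R : 'I_n.+1) \notin S) (SN : S = [set (- s)%R | s in S])
    (x : circulant S0 SN) :
  degree x = #|S|.
Proof.
rewrite /degree -(card_imset S (inj_comp (addrI x) oppr_inj)) /=.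
apply: eq_card => y; rewrite inE /adj /= /circulant_adj.
apply/idP/imsetP => [Sxy | [s Ss ->]]; last by rewrite /= opprB addrC subrK.
by exists (x - y)%R; rewrite //= opprB addrC subrK.
Qed.

Lemma dvdn_order_of_residues (n : nat) (S : {set 'I_n.+1})
    (SN : S = [set (- s)%R | s in S])
    (S_ndvd : forall s : 'I_n.+1, s \in S -> ~~ (#|S|.+1 %| s))
    (S_ncong : forall s t : 'I_n.+1, s \in S -> t \in S -> s <> t ->
                 s <> t %[mod #|S|.+1]) :
  #|S|.+1 %| n.+1.
Proof.
set m := #|S|.+1; pose res k : 'I_m := inord (k %% m).
have resE k : res k = k %% m :> nat by rewrite inordK // ltn_mod.
have res_inj : {in S &, injective (fun s : 'I_n.+1 => res s)}.
  move=> s t Ss St /(congr1 val); rewrite /= !resE => eq_st.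
  by apply/eqP; apply: contra_eqT eq_st => /eqP/(S_ncong _ _ Ss St)/eqP.
(* An injective image of [S] among exactly [#|S|] nonzero residues fills them all. *)
have res_onto : (fun s : 'I_n.+1 => res s) @: S = [set~ ord0].
  apply/eqP; rewrite eqEcard card_in_imset // cardsC1 card_ord leqnn andbT.
  apply/subsetP=> _ /imsetP[s Ss ->]; rewrite !inE -val_eqE /= resE.
  exact: S_ndvd.
apply: contraT => ndvd_m.
(* The residue of [n.+1], if nonzero, is that of some [s] in [S]. Then [m] divides [n.+1 - s], the
   representative of [- s], although [- s] is in [S]. Positivity of [s] keeps [n.+1 - s] below
   [n.+1], so that it is already reduced. *)
have : res n.+1 \in [set~ ord0] by rewrite !inE -val_eqE /= resE.
rewrite -res_onto => /imsetP[s Ss /(congr1 val)]; rewrite /= !resE => /eqP.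
have s_gt0 : 0 < s by rewrite lt0n; apply: contra (S_ndvd s Ss) => /eqP->.
rewrite eqn_mod_dvd ?(ltnW (ltn_ord s)) // => dvd_m.
have SNs : (- s)%R \in S by rewrite SN imset_f.
have := S_ndvd _ SNs; rewrite /= modn_small ?dvd_m //.
by rewrite ltn_subrL s_gt0.
Qed.

Lemma circulant_total_colorable (n m : nat) (S : {set 'I_n.+1})
    (S0 : (0%R : 'I_n.+1) \notin S) (SN : S = [set (- s)%R | s in S]) :
    odd m -> m %| n.+1 ->
    (forall s : 'I_n.+1, s \in S -> ~~ (m %| s)) ->
    (forall s t : 'I_n.+1, s \in S -> t \in S -> s <> t -> s <> t %[mod m]) ->
  total_colorable (circulant S0 SN) m.
Proof.
set G := circulant S0 SN; case: m => // m m_odd dvd_m S_ndvd S_ncong.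
have adj_neq (x y : 'I_n.+1) : (x - y)%R \in S -> x != y %[mod m.+1].
  move/S_ndvd; apply: contra => /eqP eq_xy.
  by rewrite /dvdn -(mod0n m.+1) -(eqn_modDr y) add0n ord_subDmod // eq_xy.
(* If [y] and [z] are congruent, so are [x - y] and [x - z], and congruent elements of [S] are
   equal. *)
have nbr_inj (x y z : 'I_n.+1) : (x - y)%R \in S -> (x - z)%R \in S ->
    y = z %[mod m.+1] -> y = z.
  move=> Sxy Sxz eq_yz; apply/oppr_inj/(addrI x)/eqP; apply: contraT => /eqP neq.
  case: (S_ncong _ _ Sxy Sxz neq); apply/eqP; rewrite -(eqn_modDr y).
  by rewrite ord_subDmod // -modnDmr eq_yz modnDmr ord_subDmod.
pose res k : 'I_m.+1 := inord (k %% m.+1).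
have res_eq j k : (res j == res k) = (j == k %[mod m.+1]).
  by rewrite -val_eqE /= !inordK ?ltn_mod.
(* The vertex colour is the edge formula [x + y] at [y = x], so a clash between [x] and an edge to
   [y] cancels to [x] congruent to [y]. Summing over the edge as a set avoids choosing an order of
   its endpoints. *)
pose cv := [ffun x : G => res (x + x)].
pose ce := [ffun E : edge G => res (\sum_(x in (val E : {set 'I_n.+1})) x)].
have ceE (E : edge G) (x y : 'I_n.+1) :
    adj (x : G) y -> val E = [set x; y] -> ce E = res (x + y).
  move=> xy defE; rewrite ffunE defE big_setU1 ?big_set1 // inE.
  by apply: contraTneq xy => ->; rewrite adj_irrefl.
apply/existsP; exists cv; apply/existsP; exists ce; apply/and3P; split.
- apply/forallP=> x; apply/forallP=> y; apply/implyP=> /adj_neq.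
  rewrite !ffunE res_eq !addnn; apply: contra => /eqP.
  by move/(double_modn_inj m_odd)/eqP.
- apply/forallP=> E; apply/forallP=> F; apply/implyP=> /andP[neqEF].
  case/set0Pn=> x /setIP[/edge_incidentP[y xy defE] /edge_incidentP[z xz defF]].
  rewrite (ceE E x y) // (ceE F x z) // res_eq eqn_modDl.
  apply: contra neqEF => /eqP/(nbr_inj x y z xy xz) eq_yz.
  by apply/eqP/val_inj; rewrite defE defF eq_yz.
- apply/forallP=> x; apply/forallP=> E; apply/implyP=> /edge_incidentP[y xy defE].
  by rewrite (ceE E x y) // ffunE res_eq eqn_modDl; apply: adj_neq.
Qed.

Theorem theorem2p3 (n : nat) (S : {set 'I_n.+1})
    (S0 : (0%R : 'I_n.+1) \notin S) (SN : S = [set (- s)%R | s in S])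
    (n_odd : odd n.+1)
    (S_ndvd : forall s : 'I_n.+1, s \in S -> ~~ (#|S|.+1 %| s))
    (S_ncong : forall s t : 'I_n.+1, s \in S -> t \in S -> s <> t ->
                 s <> t %[mod #|S|.+1]) :
  type_I (circulant S0 SN) /\
  total_chromatic_number (circulant S0 SN) = #|S|.+1.
Proof.
have chi : total_chromatic_number (circulant S0 SN) = #|S|.+1.
  have dvd_m := dvdn_order_of_residues SN S_ndvd S_ncong.
  rewrite /total_chromatic_number; case: ex_minnP => k col_k min_k.
  apply/eqP; rewrite eqn_leq min_k; last first.
    exact: circulant_total_colorable (dvdn_odd dvd_m n_odd) dvd_m S_ndvd S_ncong.
  (* By regularity any vertex gives the lower bound; [ord0] is one that always exists. *)
  rewrite -(@degree_circulant _ _ S0 SN ord0).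
  exact: degree_lt_total_colorable.
split; rewrite // /type_I chi /max_degree; congr _.+1.
apply/eqP; rewrite eqn_leq; apply/andP; split; last first.
  by apply/bigmax_leqP=> x _; rewrite degree_circulant.
by rewrite -(@degree_circulant _ _ S0 SN ord0) leq_bigmax.
Qed.
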